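(* Let $n$ be a positive integer and let $t,k$ be integers with $3 \le t < k$. Write $n = q(k-1) + r$ with integers $q \ge 0$ and $0 \le r \le k-2$. If $G$ is a graph on $n$ vertices containing no copy of $P_k$, then $$k_t(G) \le k_t(qK_{k-1} \cup K_r).$$ Moreover, if $t \le r$, then $qK_{k-1} \cup K_r$ is the unique $n$-vertex $P_k$-free graph attaining equality. If $t > r$, then an $n$-vertex $P_k$-free graph $G$ attains equality if and only if $G$ is isomorphic to $qK_{k-1} \cup L$ for some graph $L$ on $r$ vertices.
   Context: $P_k$ denotes the path on $k$ vertices. For a graph $G$, $k_t(G)$ denotes the number of cliques of order $t$ (copies of $K_t$) in $G$. $qK_{k-1} \cup K_r$ denotes the vertex-disjoint union of $q$ copies of the complete graph $K_{k-1}$ and one copy of $K_r$ (so $k_t(qK_{k-1}\cup K_r) = q\binom{k-1}{t} + \binom{r}{t}$); similarly $qK_{k-1}\cup L$ is the vertex-disjoint union of $q$ copies of $K_{k-1}$ and $L$. *)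

(* Defs.v *)
From mathcomp Require Import all_boot.

Set Implicit Arguments.
Unset Strict Implicit.
Unset Printing Implicit Defensive.

Record sgraph := SGraph {
  vertex :> finType;
  adj : rel vertex;
  adj_sym : symmetric adj;
  adj_irr : irreflexive adj }.

Definition isomorphic (G H : sgraph) : Prop :=
  exists f : G -> H, bijective f /\ forall x y, adj (f x) (f y) = adj x y.

(* [contains G H]: [H] is a not necessarily induced subgraph of [G]. *)
Definition contains (G H : sgraph) : Prop :=
  exists f : H -> G, injective f /\ forall x y, adj x y -> adj (f x) (f y).

Definition is_clique (G : sgraph) (S : {set G}) : bool :=
  [forall x in S, forall y in S, (x != y) ==> adj x y].

Definition num_cliques (t : nat) (G : sgraph) : nat :=
  #|[set S : {set G} | is_clique S & #|S| == t]|.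

Definition complete_rel (n : nat) : rel 'I_n := fun i j => i != j.

Lemma complete_sym n : symmetric (@complete_rel n).
Proof. by move=> i j; rewrite /complete_rel eq_sym. Qed.

Lemma complete_irr n : irreflexive (@complete_rel n).
Proof. by move=> i; rewrite /complete_rel eqxx. Qed.

Definition complete (n : nat) : sgraph :=
  SGraph (@complete_sym n) (@complete_irr n).

(* [k] counts vertices, not edges. *)
Definition path_rel (k : nat) : rel 'I_k :=
  fun i j => (i.+1 == j :> nat) || (j.+1 == i :> nat).

Lemma path_sym k : symmetric (@path_rel k).
Proof. by move=> i j; rewrite /path_rel orbC. Qed.

Lemma path_irr k : irreflexive (@path_rel k).
Proof. by move=> i; rewrite /path_rel orbb eqn_leq ltnn. Qed.

Definition path_graph (k : nat) : sgraph :=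
  SGraph (@path_sym k) (@path_irr k).

Definition union_rel (G H : sgraph) : rel (G + H)%type :=
  fun u v => match u, v with
             | inl x, inl y => adj x y
             | inr x, inr y => adj x y
             | _, _ => false
             end.

Lemma union_sym G H : symmetric (@union_rel G H).
Proof. by case=> x [] y //=; rewrite adj_sym. Qed.

Lemma union_irr G H : irreflexive (@union_rel G H).
Proof. by case=> x /=; rewrite adj_irr. Qed.

Definition disjoint_union (G H : sgraph) : sgraph :=
  SGraph (@union_sym G H) (@union_irr G H).

Definition copies_rel (q : nat) (G : sgraph) : rel ('I_q * G)%type :=
  fun u v => (u.1 == v.1) && adj u.2 v.2.

Lemma copies_sym q G : symmetric (@copies_rel q G).
Proof. by move=> u v; rewrite /copies_rel eq_sym adj_sym. Qed.

Lemma copies_irr q G : irreflexive (@copies_rel q G).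
Proof. by move=> u; rewrite /copies_rel adj_irr andbF. Qed.

Definition copies (q : nat) (G : sgraph) : sgraph :=
  SGraph (@copies_sym q G) (@copies_irr q G).

(* Main.v *)
Require Import Defs.
From mathcomp Require Import all_boot zify.

Set Implicit Arguments.
Unset Strict Implicit.
Unset Printing Implicit Defensive.

(* Kopylov's method. In a connected [P_k]-free graph on at least [k] vertices,
   made edge-maximal, two sets of minimum inner degree [a] and [b] with
   [a + b >= k - 1] are completely joined, since otherwise two long disjoint
   paths could be merged into a [P_k]. Hence for some [1 <= s <= (k - 2) / 2] the
   graph can be reduced to [k - 1 - s] vertices by deleting vertices of degree at
   most [s], so it has at most [C(k-1-s, t) + (n-k+1+s) C(s, t-1)] cliques of
   order [t]; for [t >= 3] this is strictly below the extremal value. The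
   extremal value being superadditive in [n], induction over components shows
   that equality with [n >= k - 1] forces a [K_{k-1}], which is then a component
   and can be split off. *)

(** * Binomial estimates *)

Section Binomials.

Variable t : nat.

(** Discrete convexity: by Pascal's rule each unit increment of ['C(-, t)] is a binomial with lower
    index [t - 1], which is monotone in its top. *)
Lemma bin_exchange u v x :
  u <= v -> 'C(u + x, t) + 'C(v, t) <= 'C(u, t) + 'C(v + x, t).
Proof.
move=> le_uv; case: t => [|m]; first by rewrite !bin0.
elim: x => [|x IH]; first by rewrite !addn0.
rewrite !addnS !binS.
have := leq_bin2l m (leq_add le_uv (leqnn x)); lia.
Qed.

(** The last of the unit increments is already strictly larger on the side of [v], because
    [t <= v + x] makes the relevant binomial positive. *)
Lemma bin_exchange_strict u v x :
  1 < t -> u < v -> 0 < x -> t <= v + x ->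
  'C(u + x, t) + 'C(v, t) < 'C(u, t) + 'C(v + x, t).
Proof.
case: x => // x t1 lt_uv _; have := @bin_exchange u v x (ltnW lt_uv).
case: t t1 => // -[] // m _ IH le_t.
rewrite !addnS !(binS _ m.+1).
have lt1 : 'C(u + x, m.+1) < 'C(v + x, m.+1).
  have -> : v + x = (v + x).-1.+1 by lia.
  rewrite binS.
  have : u + x <= (v + x).-1 by lia.
  move=> /(leq_bin2l m.+1).
  have : 0 < 'C((v + x).-1, m) by rewrite bin_gt0; lia.
  by lia.
by lia.
Qed.

(** By convexity ['C(-, t)] lies above the line through its value at [s] with slope ['C(s, t.-1)].
    The terms are arranged so that no truncated subtraction occurs. *)
Lemma bin_tangent r s :
  0 < t -> r * 'C(s, t.-1) + 'C(s, t) <= 'C(r, t) + s * 'C(s, t.-1).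
Proof.
case: t => // m _ /=.
have up x : 'C(s, m.+1) + x * 'C(s, m) <= 'C(s + x, m.+1).
  elim: x => [|x IH]; first by rewrite !addn0.
  rewrite addnS binS mulSn; have := leq_bin2l m (leq_addr x s); lia.
have down x : x <= s -> 'C(s, m.+1) <= 'C(s - x, m.+1) + x * 'C(s, m).
  elim: x => [|x IH] lx; first by rewrite subn0 addn0.
  have := IH (ltnW lx); have -> : s - x = (s - x.+1).+1 by lia.
  rewrite binS mulSn; have := leq_bin2l m (leq_subr x.+1 s); lia.
case: (leqP s r) => [le|lt].
  have := up (r - s); rewrite subnKC // mulnBl.
  have := leq_mul le (leqnn 'C(s, m)); lia.
have := down (s - r) (leq_subr _ _); rewrite subKn ?(ltnW lt) // mulnBl.
have := leq_mul (ltnW lt) (leqnn 'C(s, m)); lia.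
Qed.

End Binomials.

(** In falling factorials this holds factor by factor: [2s - i >= 2(s - i)]. *)
Lemma bin_double s m : 2 ^ m * 'C(s, m) <= 'C(s.*2, m).
Proof.
rewrite -(leq_pmul2r (fact_gt0 m)) -mulnA !bin_ffact.
elim: m => // m IH; rewrite !ffactnSr expnS.
have : s.*2 - m >= 2 * (s - m) by lia.
move=> H; have := leq_mul IH H; lia.
Qed.

(** Here [t 'C(K, t) = K 'C(K-1, t-1)], doubling gives a factor [2^(t-1)], and [2^(t-1) >= t + 1]
    holds exactly from [t = 3] on. *)
Lemma bin_half K s t : 2 < t -> s.*2 < K ->
  K * t.+1 * 'C(s, t.-1) <= t * 'C(K, t).
Proof.
case: t => // t ht hK; case: K hK => // K hK.
rewrite -mul_bin_diag -mulnA leq_mul2l /=.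
apply: leq_trans (leq_bin2l t (_ : s.*2 <= K)); last by lia.
apply: leq_trans (bin_double s t); rewrite leq_mul2r; apply/orP; right.
by elim: t ht => // -[|[|[|t]]] // IH _; rewrite expnS; have := IH isT; lia.
Qed.

(** * The extremal function, its superadditivity, and the gap to the connected bound *)

Section Extremal.

(* [bnd n] is [k_t(qK_{k-1} \cup K_r)] with [K = k - 1]. *)
Variables t K : nat.
Hypotheses (t3 : 2 < t) (tK : t <= K).

Definition bnd n := n %/ K * 'C(K, t) + 'C(n %% K, t).

Lemma bndE q r : r < K -> bnd (q * K + r) = q * 'C(K, t) + 'C(r, t).
Proof.
move=> rK; rewrite /bnd divnMDl ?modnMDl; last by lia.
by rewrite (divn_small rK) (modn_small rK) addn0.
Qed.

(** Only the remainders matter. By convexity, pushing them apart, to [0] and [r1 + r2] or to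
    [r1 + r2 - K] and [K], does not decrease the count. *)
Lemma bnd_superadd a b : bnd a + bnd b <= bnd (a + b).
Proof.
have K0 : 0 < K by lia.
have -> : a + b = (a %/ K + b %/ K) * K + (a %% K + b %% K).
  by rewrite mulnDl addnACA -!divn_eq.
rewrite /bnd; set r1 := a %% K; set r2 := b %% K.
have l1 : r1 < K by rewrite ltn_mod. have l2 : r2 < K by rewrite ltn_mod.
have [lt|le] := ltnP (r1 + r2) K.
  rewrite divnMDl // modnMDl (divn_small lt) (modn_small lt) addn0 mulnDl.
  have := @bin_exchange t 0 r2 r1 isT; rewrite add0n bin0n (addnC r2).
  by case: t t3 => //= *; lia.
have -> : (a %/ K + b %/ K) * K + (r1 + r2)
        = (a %/ K + b %/ K).+1 * K + (r1 + r2 - K) by rewrite mulSn; lia.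
have lt : r1 + r2 - K < K by lia.
rewrite divnMDl // modnMDl (divn_small lt) (modn_small lt) addn0 mulSn mulnDl.
have := @bin_exchange t (r1 + r2 - K) r2 (K - r2).
have -> : r1 + r2 - K + (K - r2) = r1 by lia.
by rewrite subnKC; lia.
Qed.

Lemma bnd_superadd_strict a b : a < K -> b < K -> K <= a + b ->
  'C(a, t) + 'C(b, t) < bnd (a + b).
Proof.
move=> aK bK le.
have -> : a + b = 1 * K + (a + b - K) by lia.
rewrite bndE; last by lia.
have := @bin_exchange_strict t (a + b - K) b (K - b).
have -> : a + b - K + (K - b) = a by lia.
by rewrite subnKC; lia.
Qed.

(** With [n = qK + r], the [n - (K - s)] deleted vertices are grouped as [q - 1] blocks of size [K]
    and [r + s] others. Each block costs at most ['C(K, t)], and the tangent at [s] trades the [r]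
    vertices for ['C(r, t)]. *)
Lemma kopylov_lt_bnd n s : 0 < s -> s.*2 < K -> K < n ->
  'C(K - s, t) + (n - (K - s)) * 'C(s, t.-1) < bnd n.
Proof.
move=> s0 sK Kn; have K0 : 0 < K by lia.
have half := bin_half t3 sK.
(* What remains for one copy of [K_K]: the summand [s.*2] is the [s] of the [r + s] vertices plus
   the [s] produced by the tangent. *)
have step : (s.*2 * 'C(s, t.-1)) + 'C(K - s, t) < 'C(K, t) + 'C(s, t).
  case: (posnP 'C(s, t.-1)) => [->|pos].
    rewrite muln0 add0n.
    have := @bin_exchange_strict t 0 (K - s) s; rewrite add0n subnK; last by lia.
    by rewrite (@bin_small 0); lia.
  have half2 := bin_half t3 (ltnSn s.*2).
  have base : (s.*2).+1 * 'C(s, t.-1) < 'C((s.*2).+1, t).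
    rewrite -(ltn_pmul2l (_ : 0 < t)); last by lia.
    apply: leq_trans half2.
    by rewrite mulnCA -mulnA ltn_pmul2l // ltn_pmul2r.
  (* Starting at [s.+1] turns the smaller top into [2s + 1], the value controlled by [base]; the
     excess of ['C(s.+1, t)] over ['C(s, t)] is absorbed by the extra unit in [2s + 1]. *)
  have := @bin_exchange t s.+1 (K - s) s.
  have -> : s.+1 + s = (s.*2).+1 by lia.
  rewrite subnK; last by lia.
  have : 'C(s.+1, t) = 'C(s, t) + 'C(s, t.-1).
    by case: (t) t3 => // m _; rewrite binS.
  by move: base; rewrite mulSn; lia.
have := bin_tangent (n %% K) s (ltnW (ltnW t3)).
have full : K * 'C(s, t.-1) <= 'C(K, t).
  rewrite -(leq_pmul2l (_ : 0 < t)); last by lia.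
  apply: leq_trans half; rewrite mulnA leq_mul2r; apply/orP; right; nia.
rewrite /bnd; have q0 : 0 < n %/ K by rewrite divn_gt0; lia.
have nE := divn_eq n K.
have -> : n - (K - s) = (n %/ K).-1 * K + (n %% K + s).
  rewrite {1}nE -{1}(prednK q0) mulSn; lia.
rewrite -{2}(prednK q0) mulSn !mulnDl -mulnA.
have := leq_mul (leqnn (n %/ K).-1) full.
move: step; rewrite -addnn mulnDl; lia.
Qed.

End Extremal.

(** * Cycles from paths with crossing end neighbours *)

Section Crossing.

Variables (T : eqType) (e : rel T).
Hypotheses (e_sym : symmetric e) (e_irr : irreflexive e).

Lemma rev_path_sym x p : path e x p -> path e (last x p) (rev (belast x p)).
Proof. by move=> xp; rewrite rev_path (eq_path (e' := e)). Qed.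

(** Follow [p1], jump to the far end of the path, return to [d], and close up at [x]; the segment
    [M] is skipped. *)
Lemma crossing_is_cycle x p1 M d D :
  path e x (p1 ++ M ++ d :: D) -> e (last d D) (last x p1) -> e x d ->
  cycle e (x :: p1 ++ rev (d :: D)).
Proof.
rewrite !cat_path /= => /and4P[xp1 _ _ dD] ey ex.
rewrite lastI rev_rcons rcons_cat cat_path xp1 /= e_sym ey rcons_path.
rewrite rev_path_sym //=.
by case: D {ey} dD => [|z D] _ /=; rewrite ?rev_cons ?last_rcons e_sym.
Qed.

(* Take a crossing of minimal gap: the vertices skipped by the cycle are adjacent
   to neither end, and if there are any then the neighbours of [y] are disjoint
   from the predecessors of the neighbours of [x]. *)
Lemma crossing_cycle x p i0 j0 (s := x :: p) (y := last x p) :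
  path e x p -> uniq s -> i0 < j0 -> j0 <= size p ->
  e y (nth x s i0) -> e x (nth x s j0) ->
  exists c, [/\ cycle e c, uniq c, {subset c <= s}
    & minn (size s) (count (e x) s + count (e y) s) <= size c].
Proof.
move=> xp us ij0 jp0 eyi0 exj0; set lower := minn _ _.
pose N := size s; pose sn := nth x s.
pose cr g := [exists i : 'I_N, [&& 0 < g, i + g < N, e y (sn i) & e x (sn (i + g))]].
have ex_cr : exists g, cr g.
  exists (j0 - i0); apply/existsP.
  have iN : i0 < N by rewrite /N /=; lia.
  exists (Ordinal iN) => /=; rewrite subnKC ?(ltnW ij0) //.
  by rewrite /sn eyi0 exj0 /N /= subn_gt0 ij0 ltnS jp0.
case: (ex_minnP ex_cr) => g /existsP[[i iN] /= /and4P[g0 igN eyi exj]] min_g.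
have [j jE] : exists j, j = i + g by exists (i + g).
have gE : g = j - i by lia.
have ij : i < j by lia.
rewrite -jE in igN exj; have jN := igN.
have min_cr a b : a < b -> b < N -> e y (sn a) -> e x (sn b) -> j - i <= b - a.
  move=> ab bN ea eb; rewrite -gE; apply: min_g; apply/existsP.
  exists (Ordinal (ltn_trans ab bN)) => /=.
  by rewrite subnKC ?(ltnW ab) // bN ea eb subn_gt0 ab.
have yE : y = sn N.-1 by rewrite /sn nth_last.
have x0 : sn 0 = x by [].
have no_y : ~~ e y (sn N.-1) by rewrite -yE e_irr.
have no_x : ~~ e x (sn 0) by rewrite x0 e_irr.
have pE : p = take i p ++ (drop i (take j.-1 p) ++ drop j.-1 p).
  have -> : take i p = take i (take j.-1 p) by rewrite take_takel //; lia.
  by rewrite catA !cat_take_drop.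
have dE : drop j.-1 p = sn j :: drop j p.
  have -> : drop j.-1 p = drop j s by case: (j) ij.
  by rewrite (drop_nth x).
have iy : i < size p by move: jN; rewrite /N /=; lia.
have lasti : last x (take i p) = sn i.
  rewrite -nth_last size_takel ?(ltnW iy) //.
  case: (i) iy => [|i'] lt //=; first by rewrite take0.
  by rewrite nth_take.
have lastj : last (sn j) (drop j p) = y.
  by rewrite /y {2}pE dE !last_cat /= .
(* The cycle omits exactly the positions strictly between [i] and [j]. *)
exists (take i.+1 s ++ rev (drop j s)).
have sjE : drop j s = sn j :: drop j p by rewrite -dE; case: (j) ij.
split.
- rewrite sjE /=; apply: (@crossing_is_cycle _ _ (drop i (take j.-1 p))).
  + by rewrite -dE -pE.
  + by rewrite lastj lasti.
  + exact: exj.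
- have : subseq (take i.+1 s ++ drop j s) s.
    rewrite -[X in subseq _ X](cat_take_drop j s); apply: cat_subseq => //.
    rewrite -(@take_takel _ i.+1 j) //; exact: take_subseq.
  move=> /subseq_uniq -/(_ us).
  by rewrite !cat_uniq rev_uniq has_rev.
- move=> z; rewrite mem_cat mem_rev => /orP[/mem_take|/mem_drop] //.
rewrite size_cat size_rev size_drop size_takel; last by rewrite /= ltnW.
rewrite /lower -/N.
(* If [j = i + 1], nothing is skipped and the cycle is spanning. *)
case: (ltngtP j i.+1) => [|gap|->]; first by lia.
  2: by rewrite geq_min; apply/orP; left; rewrite subnKC.
rewrite geq_min; apply/orP; right.
have countE z : count (e z) s = size [seq l <- iota 0 N | e z (sn l)].
  rewrite -[in LHS](mkseq_nth x s) /mkseq count_map size_filter.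
  by apply: eq_count.
rewrite !countE.
set IX := filter _ _; set IY := filter _ _.
have uIX : uniq IX by rewrite filter_uniq ?iota_uniq.
have inIX l : l \in IX = e x (sn l) && (l < N) by rewrite mem_filter mem_iota add0n.
have inIY l : l \in IY = e y (sn l) && (l < N) by rewrite mem_filter mem_iota add0n.
(* Minimality of the gap keeps these positions distinct and out of the skipped segment; [j] is
   removed because its predecessor lies there. They also miss the last position, so the degree sum
   is at most [i + 1 + (N - j)], the length of the cycle. *)
pose L := [seq l.-1 | l <- rem j IX] ++ IY.
have jIX : j \in IX by rewrite inIX exj.
have posX l : l \in IX -> 0 < l by rewrite inIX; case: l => //; rewrite (negPf no_x).
have inR l : l \in rem j IX = (l \in IX) && (l != j).
  by rewrite mem_rem_uniq // inE andbC.
have uL : uniq L.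
  rewrite cat_uniq filter_uniq ?iota_uniq // andbT map_inj_in_uniq ?rem_uniq //=.
    apply/hasPn => l; rewrite inIY => /andP[eyl lN]; apply/mapP => -[m].
    rewrite inR => /andP[mX mj] lE; have m0 := posX _ mX.
    have := mX; rewrite inIX => /andP[exm mN].
    have lm : l < m by clear -lE m0; lia.
    by have := min_cr l m lm mN eyl exm; clear -gap lE m0; lia.
  move=> a b; rewrite !inR => /andP[/posX a0 _] /andP[/posX b0 _]; lia.
have subL : {subset L <= iota 0 i.+1 ++ iota j (N.-1 - j)}.
  move=> l; rewrite !mem_cat !mem_iota => /orP[/mapP[m]|].
    rewrite inR => /andP[mX mj] ->; have m0 := posX _ mX.
    have := mX; rewrite inIX => /andP[exm mN].
    have [im|] := ltnP i m; last by clear -ij m0; lia.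
    by have := min_cr i m im mN eyi exm; clear -ij m0 mj mN; lia.
  rewrite inIY => /andP[eyl lN].
  have lN1 : l != N.-1 by apply: contraNneq no_y => <-.
  have [lj|] := ltnP l j; last by clear -lN lN1; lia.
  by have := min_cr l j lj jN eyl exj; clear -ij lj; lia.
have := uniq_leq_size uL subL.
rewrite /L !size_cat size_map size_rem // !size_iota.
have : 0 < size IX by case: (IX) jIX.
by move: (size IX) (size IY) => a b; clear -ij jN; lia.
Qed.

(* When [x] has a neighbour on [p], the farthest one closes a cycle through
   [x] and all its neighbours on [p]. *)
Lemma path_through_neighbours x p a :
  path e x p -> uniq (x :: p) -> a \in x :: p ->
  exists q, [/\ path e a q, uniq (a :: q), {subset a :: q <= x :: p}
    & count (e x) p <= size q].
Proof.
elim/last_ind: p => [|p z IH].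
  by rewrite mem_seq1 => _ _ /eqP ->; exists [::]; split.
move=> xp us ap; have [exz|nexz] := boolP (e x z).
  (* The whole path closes into a cycle, which is then opened at [a]. *)
  have cyc : cycle e (x :: rcons p z) by rewrite /= rcons_path xp last_rcons e_sym.
  have [i s' rE] := rot_to ap; exists s'.
  have := rot_cycle i e (x :: rcons p z); rewrite rE cyc /= rcons_path => /andP[as' _].
  split=> //.
  - by have : uniq (a :: s') by rewrite -rE rot_uniq.
  - by move=> w; rewrite -rE mem_rot.
  - have : size (a :: s') = size (x :: rcons p z) by rewrite -rE size_rot.
    by case=> ->; exact: count_size.
rewrite -cats1 count_cat /= (negPf nexz) !addn0.
have := xp; rewrite rcons_path => /andP[xp' _].
have usp : uniq (x :: p) by move: us; rewrite -rcons_cons rcons_uniq => /andP[].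
have [ap'|nap] := boolP (a \in x :: p).
  have [q [aq uq sq le]] := IH xp' usp ap'; exists q; split=> //.
  move=> w /sq; rewrite !inE mem_cat => /orP[->//|->]; by rewrite orbT.
have az : a = z.
  by move: ap; rewrite -rcons_cons mem_rcons inE (negPf nap) orbF => /eqP.
(* Here [a] is the end of the path, so traversing it backwards visits every vertex. *)
exists (rev (x :: p)); rewrite az; split.
- by have := rev_path_sym xp; rewrite last_rcons belast_rcons.
- by have : uniq (z :: rev (x :: p)) by rewrite -rev_rcons rev_uniq.
- by move=> w; rewrite -rev_rcons mem_rev -cats1.
- by rewrite size_rev /= ltnW // ltnS count_size.
Qed.

(** Cut the path at its last vertex in [A], then at the first later vertex in [B]. *)
Lemma connecting_path (A B : {pred T}) x p :
  path e x p -> uniq (x :: p) -> x \in A -> last x p \in B ->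
  (forall z, z \in A -> z \notin B) ->
  exists a r b, [/\ a \in A, b \in B, path e a (rcons r b), uniq r
    & forall z, z \in r -> (z \notin A) && (z \notin B)].
Proof.
move=> xp us xA yB dis.
have [a [q [aA aq uq qB nA]]] : exists a q, [/\ a \in A, path e a q, uniq (a :: q),
    last a q \in B & ~~ has [in A] q].
  have : has [in A] (x :: p) by rewrite /= xA.
  elim: p x xp us yB {xA} => [|z p IH] x.
    by rewrite /= orbF => _ us yB xA; exists x, [::].
  rewrite [path _ _ _]/= => /andP[exz zp] us yB hA.
  have [hA'|nA] := boolP (has [in A] (z :: p)).
    by apply: (IH z) => //; case/andP: us.
  exists x, (z :: p); split=> //; last by rewrite /= exz.
  by move: hA; rewrite -cat1s has_cat (negPf nA) orbF /= orbF.
have hB : has [in B] q.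
  case/lastP: q qB {aq uq nA} => [|q z]; first by rewrite /= (negPf (dis _ aA)).
  by rewrite last_rcons has_rcons => /= ->.
case/split_find: hB nA uq aq => b r r' bB nB.
rewrite has_cat has_rcons !negb_or => /andP[/andP[_ nA] _] uq.
rewrite cat_path => /andP[ar _].
exists a, r, b; split=> //.
  by move: uq; rewrite /= cat_uniq rcons_uniq => /andP[_ /and3P[/andP[_ ->]]].
by move=> z zr; rewrite (hasPn nA) ?(hasPn nB).
Qed.

End Crossing.

(** * Edge-maximal graphs without long paths *)

Section Graph.

Variable T : finType.
Implicit Types (e : rel T) (U : {set T}).

Definition has_path e k := [exists s : k.-tuple T, sorted e s && uniq s].

Lemma has_pathI e k s : sorted e s -> uniq s -> k <= size s -> has_path e k.
Proof.
move=> es us ks; have sz : size (take k s) == k by rewrite size_takel.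
apply/existsP; exists (Tuple sz) => /=.
by rewrite take_sorted ?take_uniq.
Qed.

Definition add_edge x y e : rel T :=
  fun u v => [|| e u v, (u == x) && (v == y) | (u == y) && (v == x)].

Definition saturated e k :=
  forall x y, x != y -> ~~ e x y -> has_path (add_edge x y e) k.

Lemma add_edge_sym x y e : symmetric e -> symmetric (add_edge x y e).
Proof.
move=> es u v; rewrite /add_edge es; congr (_ || _); rewrite orbC.
by congr (_ || _); rewrite andbC.
Qed.

Lemma add_edgeC x y e u v : add_edge x y e u v = add_edge y x e u v.
Proof. by rewrite /add_edge; congr (_ || _); rewrite orbC. Qed.

Lemma add_edge_irr x y e : x != y -> irreflexive e -> irreflexive (add_edge x y e).
Proof.
move=> nxy ei u; rewrite /add_edge ei /=.
by rewrite [X in _ || X]andbC orbb; apply/andP => -[/eqP ->]; rewrite (negPf nxy).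
Qed.

(** Missing edges are added as long as no [P_k] appears; the number of nonadjacent ordered pairs
    decreases each time. *)
Lemma saturation e k : symmetric e -> irreflexive e -> ~~ has_path e k ->
  exists e', [/\ symmetric e', irreflexive e', subrel e e', ~~ has_path e' k
    & saturated e' k].
Proof.
have [n] := ubnP #|[set p | ~~ e p.1 p.2]|.
elim: n e => // n IH e /ltnSE le es ei ne.
have [/existsP[x /existsP[y /and3P[nxy nexy ne']]]|sat] :=
  boolP [exists x, exists y, [&& x != y, ~~ e x y & ~~ has_path (add_edge x y e) k]].
  have sub : subrel e (add_edge x y e) by move=> u v; rewrite /add_edge => ->.
  have [|||e' [e's e'i se' ne'' sat]] := IH (add_edge x y e) _ _ _ ne'.
  - apply: leq_trans le; apply: proper_card; apply/properP; split.
      by apply/subsetP => p; rewrite !inE; apply: contra => /sub.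
    by exists (x, y); rewrite !inE ?nexy //= /add_edge !eqxx orbT.
  - exact: add_edge_sym.
  - exact: add_edge_irr.
  - by exists e'; split=> // u v /sub /se'.
exists e; split=> // x y nxy nexy.
move/existsPn/(_ x)/existsPn/(_ y): sat.
by rewrite nxy nexy negbK.
Qed.

Lemma add_edge_path_notin x y e z p :
  x \notin z :: p -> path (add_edge x y e) z p -> path e z p.
Proof.
elim: p z => //= w p IH z; rewrite !inE !negb_or => /and3P[xz xw xp].
rewrite /add_edge ![_ == x]eq_sym (negPf xz) (negPf xw) /= andbF !orbF.
by move=> /andP[-> wp]; apply: IH => //; rewrite inE negb_or xw.
Qed.

(** A path with distinct vertices uses the new edge at most once: after it, one of the two endpoints
    can no longer occur. *)
Lemma add_edge_path_split x y e z p :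
    path (add_edge x y e) z p -> uniq (z :: p) ->
  path e z p \/ exists s1 s2 u v,
    [/\ z :: p = rcons s1 u ++ v :: s2, sorted e (rcons s1 u), path e v s2
      & (u, v) = (x, y) \/ (u, v) = (y, x)].
Proof.
elim: p z => [|w p IH] z; first by left.
rewrite [path _ _ _]/= => /andP[zw wp] /andP[zwp uwp].
have [ezw|nezw] := boolP (e z w); last first.
  move: zw; rewrite /add_edge (negPf nezw) /= => /orP[]/andP[/eqP zE /eqP wE].
    right; exists [::], p, z, w; split=> //; last by left; rewrite zE wE.
    by apply: (add_edge_path_notin _ wp); rewrite -zE.
  right; exists [::], p, z, w; split=> //; last by right; rewrite zE wE.
  apply: (@add_edge_path_notin y x); first by rewrite -zE.
  by rewrite -(eq_path (add_edgeC x y e)).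
have [ewp|[s1 [s2 [u [v [E es1 es2 uv]]]]]] := IH w wp uwp.
  by left; rewrite /= ezw.
right; exists (z :: s1), s2, u, v; split=> //; first by rewrite E.
by case: s1 E es1 => [|a s1] /= [<- _] //=; rewrite ezw // => ->.
Qed.

(** A long path in the enlarged graph must use the new edge; deleting that edge leaves two disjoint
    paths, which are read outwards from [x] and [y]. *)
Lemma add_edge_has_path x y e k : symmetric e ->
    ~~ has_path e k -> has_path (add_edge x y e) k ->
  exists A B, [/\ path e x A, path e y B, uniq ((x :: A) ++ (y :: B))
    & k <= size ((x :: A) ++ (y :: B))].
Proof.
move=> es ne /existsP[s /andP[ss us]].
have := size_tuple s; case E: (val s) ss us => [|z p] /= ss us sz.
  by case/negP: ne; apply: (@has_pathI _ _ [::]); rewrite -?sz.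
have [zp|] := add_edge_path_split ss us.
  by case/negP: ne; apply: (@has_pathI _ _ (z :: p)); rewrite -?sz.
move=> [s1 [s2 [u [v [{}E es1 es2 uv]]]]].
have eu : path e u (rev s1).
  have : sorted e (rev (rcons s1 u)).
    by rewrite rev_sorted; case: (rcons s1 u) es1 => //= a l; rewrite (eq_path (e' := e)).
  by rewrite rev_rcons.
have pE : perm_eq ((u :: rev s1) ++ (v :: s2)) (z :: p).
  by rewrite E perm_cat2r -rev_rcons perm_rev.
have usp : uniq ((u :: rev s1) ++ (v :: s2)) by rewrite (perm_uniq pE).
have szp : k <= size ((u :: rev s1) ++ (v :: s2)) by rewrite (perm_size pE) -sz.
case: uv => -[uE vE]; subst u v; first by exists (rev s1), s2.
exists s2, (rev s1); split=> //.
  by rewrite -cons_uniq -cat_cons uniq_catC.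
by move: szp; rewrite !size_cat /=; lia.
Qed.

(** * Merging two disjoint paths in a connected graph *)

Section Joining.

Variables (e : rel T) (k : nat).
Hypotheses (e_sym : symmetric e) (e_irr : irreflexive e).
Hypothesis e_conn : forall x y, connect e x y.

(* A path in [G] is a path in [G + apex] avoiding the apex [None]. *)
Definition apex_rel : rel (option T) := fun u v =>
  match u, v with Some a, Some b => e a b | None, None => false | _, _ => true end.

Lemma apex_sym : symmetric apex_rel.
Proof. by case=> [a|] [b|] //=. Qed.

Lemma apex_irr : irreflexive apex_rel.
Proof. by case=> [a|] //=. Qed.

Lemma path_apex x p : path apex_rel (Some x) (map Some p) = path e x p.
Proof. by elim: p x => //= y p IH x; rewrite IH. Qed.

Lemma some_seq (s : seq (option T)) : None \notin s -> exists s', s = map Some s'.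
Proof.
elim: s => [|[a|] s IH]; [by exists [::] | | by rewrite inE].
by rewrite inE /= => /IH[s' ->]; exists (a :: s').
Qed.

(** Opening the cycle at the apex costs one vertex, so at least [k] vertices of [e] remain; a cycle
    without the apex loses none. *)
Lemma apex_cycle c : cycle apex_rel c -> uniq c -> k < size c -> has_path e k.
Proof.
move=> cc uc kc; have [Nc|Nc] := boolP (None \in c).
  have [i s sE] := rot_to Nc.
  have := rot_cycle i apex_rel c; rewrite sE cc => cs.
  have us : uniq (None :: s) by rewrite -sE rot_uniq.
  have sz : size c = (size s).+1 by rewrite -(size_rot i) sE.
  case/andP: us => /some_seq[s' s'E] us; subst s.
  apply: (@has_pathI _ _ s').
  - move: cs; case: (s') => //= a l.
    by rewrite rcons_path path_apex => /andP[].
  - by rewrite -(map_inj_uniq (f := Some)) // => a b [].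
  - by move: kc; rewrite sz size_map ltnS.
have [s' s'E] := some_seq Nc; subst c.
apply: (@has_pathI _ _ s').
- move: cc; case: (s') => //= a l.
  by rewrite rcons_path path_apex => /andP[].
- by rewrite -(map_inj_uniq (f := Some)) // => a b [].
- by move: kc; rewrite size_map; apply: ltnW.
Qed.

(* Kopylov's lemma: [x :: A] and [y :: B] are joined by the apex into one path;
   either its ends have crossing neighbours, or all neighbours of [x] are on
   [A] and all neighbours of [y] are on [B]. *)
Lemma join_paths x A y B : path e x A -> path e y B ->
    uniq ((x :: A) ++ (y :: B)) -> ~~ e x y ->
    k <= size ((x :: A) ++ (y :: B)) ->
    k <= (count (e x) (A ++ B) + count (e y) (A ++ B)).+1 ->
  has_path e k.
Proof.
move=> xA yB us nexy sz deg.
have := us; rewrite cat_uniq => /and3P[uA /hasPn dis uB].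
(* The path runs from [x] along [A], through the apex, and back along [B] to its end [y]. *)
pose p := map Some A ++ None :: map Some (rev (y :: B)).
have lp : last (Some x) p = Some y.
  by rewrite /p rev_cons map_rcons -cats1 -cat_cons catA last_cat.
have xp : path apex_rel (Some x) p.
  rewrite cat_path path_apex xA last_map (lastI y B) rev_rcons /=.
  by rewrite path_apex rev_path_sym.
have up : uniq (Some x :: p).
  have -> : Some x :: p = map Some (x :: A) ++ None :: map Some (rev (y :: B)) by [].
  rewrite cat_uniq map_inj_uniq ?uA; last by move=> ? ? [].
  rewrite [uniq (None :: _)]/= map_inj_uniq ?rev_uniq ?uB ?andbT; last by move=> ? ? [].
  rewrite /= negb_or -andbA.
  apply/and3P; split.
  - by apply/negP; rewrite inE => /orP[|/mapP[]].
  - apply/hasPn => _ /mapP[w wB ->]; rewrite mem_rev in wB.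
    apply: contra (dis _ wB); rewrite -[Some x :: _]/(map Some (x :: A)).
    by rewrite mem_map // => ? ? [].
  - by apply/mapP => -[].
have szp : size (Some x :: p) = (size ((x :: A) ++ (y :: B))).+1.
  by rewrite /= /p !size_cat /= !size_map size_rev /=; clear; lia.
have cnt z : count (apex_rel (Some z)) (Some x :: p)
    = (count (e z) ((x :: A) ++ (y :: B))).+1.
  have -> : Some x :: p = map Some (x :: A) ++ None :: map Some (rev (y :: B)) by [].
  have cntS l : count (apex_rel (Some z)) (map Some l) = count (e z) l.
    by rewrite count_map.
  by rewrite count_cat -(cat1s None) count_cat !cntS count_rev count_cat addnCA.
(* The apex is one more neighbour of each end, so the degree sum is at least [k + 1], and so is the
   length of the cycle. *)
have cross i j : i < j -> j <= size p ->
    apex_rel (Some y) (nth (Some x) (Some x :: p) i) ->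
    apex_rel (Some x) (nth (Some x) (Some x :: p) j) -> has_path e k.
  rewrite -{1}lp => ij jp yi xj.
  have [c [cc uc _ lec]] := crossing_cycle apex_sym apex_irr xp up ij jp yi xj.
  apply: (apex_cycle cc uc); apply: leq_trans lec.
  rewrite leq_min szp ltnS sz lp !cnt.
  by move: deg; rewrite !count_cat /=; clear; lia.
have szA : size A < size p by rewrite /p size_cat /= size_map; clear; lia.
have atN : nth (Some x) (Some x :: p) (size A).+1 = None.
  by rewrite /= /p nth_cat size_map ltnn subnn.
(* A neighbour of [x] on [B] comes after the apex, which is a neighbour of [y]: a crossing. *)
have [/hasP[u uB' exu]|/hasPn nxB] := boolP (has (e x) B).
  have uI : Some u \in map Some (rev (y :: B)).
    by rewrite mem_map ?mem_rev ?inE ?uB' ?orbT // => ? ? [].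
  pose j := index (Some u) (map Some (rev (y :: B))).
  have jlt : j < size (map Some (rev (y :: B))) by rewrite index_mem.
  apply: (cross (size A).+1 ((size A).+2 + j)); first by clear; lia.
  - by move: jlt; rewrite /p size_cat /= !size_map; clear; lia.
  - by rewrite atN.
  have -> : (size A).+2 + j = ((size A).+1 + j).+1 by clear; lia.
  rewrite /= /p nth_cat size_map ifN; last by clear; lia.
  have -> : (size A).+1 + j - size A = j.+1 by clear; lia.
  by rewrite /= nth_index.
(* Symmetrically, a neighbour of [y] on [A] comes before the apex, now used as a neighbour of
   [x]. *)
have [/hasP[u uA' eyu]|/hasPn nyA] := boolP (has (e y) A).
  have uI : index u (x :: A) < size (x :: A) by rewrite index_mem inE uA' orbT.
  apply: (cross (index u (x :: A)) (size A).+1) => //.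
  - have -> : Some x :: p = map Some (x :: A) ++ None :: map Some (rev (y :: B)) by [].
    by rewrite nth_cat size_map uI (nth_map x) // nth_index // inE uA' orbT.
  - by rewrite atN.
(* Without a crossing, connectedness links the two paths at some [a] and [b]; from each of these a
   path inside its own side is long enough to account for the degree of [x], respectively [y]. *)
have /connectP[w0 xw0 yE] := e_conn x y.
case/shortenP: xw0 yE => w xw uw _ yE.
have disA z : z \in x :: A -> z \notin y :: B by apply: contraL => /dis.
have yw : last x w \in y :: B by rewrite -yE mem_head.
have [a [r [b [aA bB ar ur nr]]]] := connecting_path xw uw (mem_head x A) yw disA.
have [qa [aqa ua sa lea]] := path_through_neighbours e_sym xA uA aA.
have [qb [bqb ub sb leb]] := path_through_neighbours e_sym yB uB bB.
apply: (@has_pathI _ _ (rev (a :: qa) ++ r ++ b :: qb)).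
- rewrite lastI rev_rcons /= cat_path rev_path_sym //=.
  have -> : last (last a qa) (rev (belast a qa)) = a.
    by case: (qa) => // z q; rewrite rev_cons last_rcons.
  by rewrite -cat_rcons cat_path ar last_rcons.
- rewrite !cat_uniq rev_uniq ua ub ur has_cat negb_or !andTb !andbT -andbA.
  apply/and3P; split; first last.
   + by apply/hasPn => z /sb zB; apply/negP => /nr; rewrite zB andbF.
  + apply/hasPn => z /sb zB; rewrite mem_rev; apply/negP => /sa.
    by apply/negP; apply: dis.
  + by apply/hasPn => z /nr /andP[zA _]; rewrite mem_rev; apply: contra zA => /sa.
- rewrite !size_cat size_rev /=; move: deg; rewrite !count_cat.
  have -> : count (e x) B = 0 by apply/eqP; rewrite -leqn0 leqNgt -has_count; apply/hasPn.
  have -> : count (e y) A = 0 by apply/eqP; rewrite -leqn0 leqNgt -has_count; apply/hasPn.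
  rewrite addn0 add0n => deg'; apply: leq_trans deg' _.
  by rewrite addSn !addnS ltnS leqW // leq_add // (leq_trans leb) // leq_addl.
Qed.

(* Among the nonadjacent pairs take one for which the two disjoint paths are
   longest; then all neighbours in [D] and [E] of its ends are on the paths. *)
Lemma saturated_joined (D E : {set T}) a b :
    ~~ has_path e k -> saturated e k ->
    {in D, forall x, a <= #|[set u in D | e x u]|} ->
    {in E, forall y, b <= #|[set u in E | e y u]|} ->
    k <= (a + b).+1 ->
  {in D & E, forall x y, x != y -> e x y}.
Proof.
move=> nk sat degD degE kab.
have stuck x y A B : x \in D -> y \in E -> x != y -> ~~ e x y ->
    path e x A -> path e y B -> uniq ((x :: A) ++ (y :: B)) ->
    k <= size ((x :: A) ++ (y :: B)) -> False.
  (* Maximality of the paths is replaced by induction on the number of uncovered vertices. *)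
  have [n] := ubnP (#|T| - size ((x :: A) ++ (y :: B))).
  elim: n x y A B => // n IH x y A B /ltnSE le xD yE nxy nexy xA yB us sz.
  have longer (s : seq T) : uniq s -> size s = (size ((x :: A) ++ (y :: B))).+1 ->
      #|T| - size s < n.
    move=> us' sE; have := max_card (mem s).
    by rewrite (card_uniqP us') sE; move: le; clear; lia.
  (* A common neighbour off both paths would link [x] to [y] and give a [P_k]. *)
  have through u : e x u -> e y u -> u \notin (x :: A) ++ (y :: B) -> False.
    move=> exu eyu nu; case/negP: nk.
    apply: (@has_pathI _ _ (rev (x :: A) ++ u :: y :: B)).
    - rewrite lastI rev_rcons /= cat_path rev_path_sym //=.
      have -> : last (last x A) (rev (belast x A)) = x.
        by case: (A) => // z q; rewrite rev_cons last_rcons.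
      by rewrite exu e_sym eyu yB.
    - have : perm_eq (rev (x :: A) ++ u :: y :: B) (u :: (x :: A) ++ (y :: B)).
        by rewrite -(cat1s u (y :: B)) perm_catCA perm_cons perm_cat2r perm_rev.
      by move/perm_uniq ->; rewrite cons_uniq nu.
    - by move: sz; rewrite !size_cat size_rev /=; clear; lia.
  have [/existsP[u /and3P[uD exu nu]]|allx] :=
      boolP [exists u, [&& u \in D, e x u & u \notin (x :: A) ++ (y :: B)]].
    (* Otherwise [u] takes the place of [x]: it is in [D], not adjacent to [y], and starts a longer
       path. *)
    have [/through-/(_ exu nu)//|neyu] := boolP (e y u).
    have uu : uniq ((u :: x :: A) ++ (y :: B)) by rewrite cat_cons cons_uniq nu.
    apply: (IH u y (x :: A) B) => //.
    - exact: longer.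
    - by apply: contraNneq nexy => <-; rewrite e_sym in exu *.
    - by rewrite e_sym.
    - by rewrite /= e_sym exu.
    - by rewrite /= leqW.
  have [/existsP[u /and3P[uE eyu nu]]|ally] :=
      boolP [exists u, [&& u \in E, e y u & u \notin (x :: A) ++ (y :: B)]].
    have [exu|nexu] := boolP (e x u); first exact: (through u).
    have pu : perm_eq ((x :: A) ++ (u :: y :: B)) (u :: (x :: A) ++ (y :: B)).
      by rewrite -(cat1s u (y :: B)) perm_catCA.
    have uu : uniq ((x :: A) ++ (u :: y :: B)) by rewrite (perm_uniq pu) cons_uniq nu.
    apply: (IH x u A (y :: B)) => //.
    - by apply: longer => //; rewrite (perm_size pu).
    - by apply: contraNneq nexy => ->; rewrite e_sym.
    - by rewrite /= e_sym eyu.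
    - by rewrite (perm_size pu) /= leqW.
  have bound (F : {set T}) z c : c <= #|[set u in F | e z u]| ->
      ~~ [exists u, [&& u \in F, e z u & u \notin (x :: A) ++ (y :: B)]] ->
      c <= count (e z) ((x :: A) ++ (y :: B)).
    move=> lec /existsPn all; apply: leq_trans lec _.
    rewrite -size_filter -(card_uniqP (filter_uniq (e z) us)).
    apply/subset_leq_card/subsetP => u; rewrite inE mem_filter => /andP[uF ezu].
    by have := all u; rewrite uF ezu /= negbK.
  case/negP: nk; apply: (@join_paths x A y B) => //.
  have := bound D x a (degD x xD) allx; have := bound E y b (degE y yE) ally.
  by rewrite !count_cat /= !e_irr (e_sym y) (negPf nexy); move: kab; clear; lia.
move=> x y xD yE nxy; apply: contraT => nexy.
have [A [B [xA yB us sz]]] := add_edge_has_path e_sym nk (sat x y nxy nexy).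
by case: (stuck x y A B).
Qed.

End Joining.

End Graph.

(** * Counting cliques *)

Section Cliques.

Variable T : finType.
Implicit Types (e : rel T) (S U W : {set T}).

Definition clique e S := [forall x in S, forall y in S, (x != y) ==> e x y].

Definition cliques_in e t U :=
  #|[set S : {set T} | [&& S \subset U, clique e S & #|S| == t]]|.

Definition nbrs_in e U x := [set u in U | e x u].

Lemma cliqueP e S : reflect {in S &, forall x y, x != y -> e x y} (clique e S).
Proof.
apply: (iffP forall_inP) => [H x y xS yS|H x xS].
  by move/implyP: (forall_inP (H x xS) y yS).
by apply/forall_inP => y yS; apply/implyP; apply: H.
Qed.

Lemma clique_sub e S U : S \subset U -> clique e U -> clique e S.
Proof.
by move=> /subsetP SU /cliqueP cU; apply/cliqueP => x y /SU xU /SU yU; apply: cU.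
Qed.

Lemma cliques_in_le_bin e t U : cliques_in e t U <= 'C(#|U|, t).
Proof.
rewrite -cards_draws; apply/subset_leq_card/subsetP => S.
by rewrite !inE => /and3P[-> _ ->].
Qed.

Lemma cliques_in_clique e t U : clique e U -> cliques_in e t U = 'C(#|U|, t).
Proof.
move=> cU; rewrite -cards_draws; apply: eq_card => S; rewrite !inE.
by case SU: (S \subset U) => //=; rewrite (clique_sub SU cU).
Qed.

(** Equality makes every [t]-subset of [U] a clique, and any two vertices lie in such a subset. *)
Lemma cliques_in_full e t U :
  t <= #|U| -> 1 < t -> cliques_in e t U = 'C(#|U|, t) -> clique e U.
Proof.
move=> tU t1 eq_bin; apply/cliqueP => x y xU yU nxy.
have sub : [set S : {set T} | [&& S \subset U, clique e S & #|S| == t]]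
    \subset [set S : {set T} | (S \subset U) && (#|S| == t)].
  by apply/subsetP => S; rewrite !inE => /and3P[-> _ ->].
have eqS := eqP (etrans (esym (subset_leqif_cards sub).2) _).
have /eqS {}eqS : cliques_in e t U == #|[set S : {set T} | (S \subset U) && (#|S| == t)]|.
  by rewrite cards_draws eq_bin.
pose V := U :\ x :\ y.
have cV : #|U| = #|V|.+2.
  by rewrite (cardsD1 x) xU (cardsD1 y) !inE eq_sym nxy yU.
have : 0 < 'C(#|V|, t.-2) by rewrite bin_gt0; lia.
rewrite -cards_draws => /card_gt0P[S]; rewrite !inE => /andP[SV /eqP cS].
have /subsetP SVs := SV.
have xS : x \notin S by apply/negP => /SVs; rewrite !inE eqxx andbF.
have yS : y \notin S by apply/negP => /SVs; rewrite !inE eqxx.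
have : x |: (y |: S) \in [set S : {set T} | (S \subset U) && (#|S| == t)].
  rewrite inE !cardsU1 !inE (negPf nxy) xS yS cS !subUset !sub1set xU yU /=.
  apply/andP; split; last by lia.
  by apply: subset_trans SV (subset_trans (subD1set _ _) (subD1set _ _)).
rewrite -eqS inE => /and3P[_ /cliqueP cl _].
by apply: cl => //; rewrite !inE eqxx ?orbT.
Qed.

Lemma cliques_in_subrel e e' t U :
  subrel e e' -> cliques_in e t U <= cliques_in e' t U.
Proof.
move=> sub; apply/subset_leq_card/subsetP => S.
rewrite !inE => /and3P[-> /cliqueP cS ->]; rewrite andbT /=.
by apply/cliqueP => x y xS yS nxy; apply/sub/cS.
Qed.

(** A clique through [v] is determined by its other [t] vertices, all of them neighbours of [v]. *)
Lemma cliques_in_remove e t U v : v \in U ->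
  cliques_in e t.+1 U <= cliques_in e t.+1 (U :\ v) + 'C(#|nbrs_in e U v|, t).
Proof.
move=> vU; rewrite /cliques_in -cards_draws.
set F := [set S | _]; set F1 := [set S | _]; set F2 := [set S | _].
rewrite -(cardsID [set S : {set T} | v \in S] F) addnC leq_add //.
  apply/subset_leq_card/subsetP => S; rewrite !inE => /andP[vS /and3P[SU -> ->]].
  by rewrite !andbT subsetD1 SU.
rewrite -(card_in_imset (f := fun S : {set T} => S :\ v)); last first.
  move=> S S'; rewrite !inE => /andP[_ vS] /andP[_ vS'] eqS.
  by rewrite -(setD1K vS) eqS setD1K.
apply/subset_leq_card/subsetP => _ /imsetP[S + ->].
rewrite !inE => /andP[/and3P[/subsetP SU /cliqueP cS /eqP szS] vS].
apply/andP; split; last by rewrite -eqSS -szS (cardsD1 v S) vS.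
apply/subsetP => w; rewrite !inE => /andP[wv wS].
by rewrite SU //= cS // eq_sym.
Qed.

(** While more than [m] vertices remain, some vertex has at most [s] neighbours among them; deleting
    it destroys at most ['C(s, t)] cliques. *)
Lemma cliques_in_degenerate e t m s U :
    (forall W, {in W, forall x, s < #|nbrs_in e W x|} -> #|W| <= m) ->
    m <= #|U| ->
  cliques_in e t.+1 U <= 'C(m, t.+1) + (#|U| - m) * 'C(s, t).
Proof.
move=> core; have [n] := ubnP #|U|; elim: n U => // n IH U /ltnSE le.
rewrite leq_eqVlt => /orP[/eqP ->|mU].
  by rewrite subnn addn0 cliques_in_le_bin.
have [v vU dv] : exists2 v, v \in U & #|nbrs_in e U v| <= s.
  apply/exists_inP; rewrite -[_ _ _]negbK; apply/negP => /exists_inPn all.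
  by move: mU; rewrite ltnNge core // => x xU; rewrite ltnNge all.
have cU : #|U| = #|U :\ v|.+1 by rewrite (cardsD1 v) vU.
apply: leq_trans (cliques_in_remove e t vU) _.
rewrite cU subSn; last by lia.
rewrite mulSn addnCA addnC leq_add ?leq_bin2l //.
by apply: IH; lia.
Qed.

Lemma clique_nbrs e S x : irreflexive e -> clique e S -> x \in S ->
  #|nbrs_in e S x| = #|S|.-1.
Proof.
move=> ei /cliqueP cS xS; rewrite (cardsD1 x S) xS /=; apply: eq_card => u.
rewrite !inE; case: (boolP (u \in S)) => uS; last by rewrite andbF.
by case: (eqVneq u x) => [->|ux] /=; rewrite ?ei // cS // eq_sym.
Qed.

Lemma clique_path e S x : clique e S -> x \in S -> path e x (rem x (enum S)).
Proof.
move=> /cliqueP cS xS.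
have : uniq (x :: rem x (enum S)).
  by rewrite /= mem_rem_uniqF ?rem_uniq ?enum_uniq.
have : {subset x :: rem x (enum S) <= S}.
  by move=> z; rewrite inE => /orP[/eqP ->//|/mem_rem]; rewrite mem_enum.
move: (rem x _) => p; elim: p x xS => //= y p IH x _ sub /andP[xyp uyp].
rewrite cS ?sub ?mem_head ?inE ?eqxx ?orbT //=.
  by apply: IH => // [|z zp]; apply: sub; rewrite inE ?zp ?mem_head orbT.
by apply: contraNneq xyp => ->; rewrite mem_head.
Qed.

Lemma clique_uniq_path S x : x \in S ->
  uniq (x :: rem x (enum S)) /\ size (x :: rem x (enum S)) = #|S|.
Proof.
move=> xS; rewrite /= mem_rem_uniqF ?rem_uniq ?enum_uniq // size_rem ?mem_enum //.
by rewrite -cardE prednK //; apply/card_gt0P; exists x.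
Qed.

Lemma clique_size_path e S k : clique e S -> k <= #|S| -> has_path e k.
Proof.
case: (set_0Vmem S) => [->|[x xS]] cS.
  by rewrite cards0 leqn0 => /eqP ->; apply: (@has_pathI _ _ _ [::]).
have [us <-] := clique_uniq_path xS.
by apply: has_pathI us => /=; apply: clique_path.
Qed.

(** An edge leaving the clique would extend one of its Hamiltonian paths. *)
Lemma clique_closed e S u v : symmetric e -> clique e S ->
  ~~ has_path e #|S|.+1 -> u \in S -> v \notin S -> ~~ e u v.
Proof.
move=> es cS nk uS vS; apply: contra nk => euv.
have [us sz] := clique_uniq_path uS.
apply: (@has_pathI _ _ _ (v :: u :: rem u (enum S))); last by rewrite -sz.
  by rewrite /= es euv clique_path.
rewrite cons_uniq us andbT inE negb_or; apply/andP; split.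
  by apply: contraNneq vS => ->.
by apply: contra vS => /mem_rem; rewrite mem_enum.
Qed.

Lemma connect_closed e S x y :
  (forall u v, u \in S -> v \notin S -> ~~ e u v) -> connect e x y ->
  x \in S -> y \in S.
Proof.
move=> cl /connectP[p xp ->]; elim: p x xp => //= z p IH x /andP[xz zp] xS.
by apply: IH zp _; apply: contraLR xz => zS; apply: cl.
Qed.

(** * Kopylov's bound for connected graphs *)

Section Connected.

Variables (e : rel T) (K : nat).
Hypotheses (e_sym : symmetric e) (e_irr : irreflexive e).
Hypothesis e_conn : forall x y, connect e x y.
Hypothesis e_free : ~~ has_path e K.+1.
Hypothesis K_lt : K < #|T|.

(** More than [K] vertices would contain the forbidden path; exactly [K] would form a whole
    component, contradicting [K < #|T|]. *)
Lemma connected_clique_lt S : clique e S -> #|S| < K.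
Proof.
move=> cS; rewrite ltnNge; apply/negP; rewrite leq_eqVlt => /orP[/eqP KS|KS]; last first.
  by move: e_free; rewrite (clique_size_path cS).
have [S0|[x xS]] := set_0Vmem S.
  have /card_gt0P[x _] : 0 < #|T| by apply: leq_ltn_trans K_lt.
  move: e_free; rewrite KS S0 cards0; case/negP.
  exact: (@has_pathI _ _ _ [:: x]).
have : setT \subset S.
  apply/subsetP => y _; apply: connect_closed (e_conn x y) xS => u v uS vS.
  by apply: clique_closed cS _ uS vS; rewrite // -KS.
by move/subset_leq_card; rewrite cardsT leqNgt -KS K_lt.
Qed.

(** Either [s = d = (K - 1) / 2], rounded down, already works, or a largest set [S] of inner degree
    above [d] is a clique and [s = K - #|S|] works. *)
Lemma kopylov_core : 2 < K -> saturated e K.+1 ->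
  exists s, [/\ 0 < s, s.*2 < K
    & forall W, {in W, forall x, s < #|nbrs_in e W x|} -> #|W| <= K - s].
Proof.
move=> K2 sat; pose d := K.-1./2.
have d0 : 0 < d by rewrite /d; lia.
have dK : d.*2 < K by rewrite /d; lia.
have Kd : K <= d.+1.*2 by rewrite /d; lia.
pose dense W := [forall x in W, d < #|nbrs_in e W x|].
have [/forallP small|] := boolP [forall W : {set T}, dense W ==> (#|W| <= K - d)].
  exists d; split=> // W degW; apply: (implyP (small W)).
  exact/forall_inP.
rewrite negb_forall => /existsP[W0]; rewrite negb_imply -ltnNge => /andP[dW0 cW0].
case: (arg_maxnP (fun W : {set T} => #|W|) dW0) => S dS maxS.
have KS : K - d < #|S| := leq_trans cW0 (maxS _ dW0).
have degS : {in S, forall x, d < #|nbrs_in e S x|} by apply/forall_inP.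
(* [S] is joined to itself, since [2(d + 1) >= K]. *)
have cS : clique e S.
  apply/cliqueP.
  apply: (saturated_joined e_sym e_irr e_conn e_free sat degS degS).
  by rewrite ltnS addnn.
have SK := connected_clique_lt cS.
exists (K - #|S|); split; [by lia | by lia |] => W degW.
have degS' : {in S, forall x, #|S|.-1 <= #|nbrs_in e S x|}.
  by move=> x xS; rewrite clique_nbrs.
(* The inner degrees [#|S| - 1] and [K - #|S| + 1] add up to exactly [K]. *)
have joined : {in S & W, forall x y, x != y -> e x y}.
  apply: (saturated_joined e_sym e_irr e_conn e_free sat degS' degW).
  by lia.
rewrite subKn; last by lia.
have [/subset_leq_card//|/subsetPn[y yW yS]] := boolP (W \subset S).
(* A vertex of [W] outside [S] would enlarge the clique, against the choice of [S]. *)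
have cyS : clique e (y |: S).
  apply/cliqueP => u v; rewrite !inE => /orP[/eqP ->|uS] /orP[/eqP ->|vS] nuv.
  - by rewrite eqxx in nuv.
  - by rewrite e_sym joined // eq_sym.
  - exact: joined.
  - exact: (cliqueP _ _ cS).
have szyS : #|y |: S| = #|S|.+1 by rewrite cardsU1 yS.
have : dense (y |: S).
  by apply/forall_inP => x xyS; rewrite clique_nbrs // szyS /=; lia.
by move/maxS; rewrite /= szyS ltnn.
Qed.

End Connected.

(** Saturating keeps the graph connected and loses no cliques, so it is enough to bound the
    saturated graph by peeling. *)
Lemma connected_cliques_lt e t K :
    symmetric e -> irreflexive e -> (forall x y, connect e x y) ->
    ~~ has_path e K.+1 -> K < #|T| -> 2 < t -> t <= K ->
  cliques_in e t setT < bnd t K #|T|.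
Proof.
move=> es ei ec ef KT t2 tK.
have [e' [e's e'i ee' e'f sat]] := saturation es ei ef.
have e'c x y : connect e' x y.
  by apply: connect_sub (ec x y) => u v /ee'; apply: connect1.
apply: leq_ltn_trans (cliques_in_subrel _ _ ee') _.
have [s [s0 sK core]] := kopylov_core e's e'i e'c e'f KT (leq_trans t2 tK) sat.
case: t t2 tK => // t t2 tK.
apply: leq_ltn_trans (kopylov_lt_bnd t2 tK s0 sK KT).
rewrite -[#|T|]cardsT; apply: cliques_in_degenerate core _.
by rewrite cardsT; lia.
Qed.

End Cliques.

(** * Isomorphism and the induction over components *)

Lemma num_cliquesE t (G : sgraph) : num_cliques t G = cliques_in (@adj G) t setT.
Proof. by apply: eq_card => S; rewrite !inE subsetT. Qed.

Lemma has_path_contains (G : sgraph) k :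
  has_path (@adj G) k -> contains G (path_graph k).
Proof.
move=> /existsP[s /andP[ss us]]; exists (tnth s); split; first exact/tuple_uniqP.
have step (i j : 'I_k) : i.+1 = j -> adj (tnth s i) (tnth s j).
  have x0 := tnth s i; move=> ij; rewrite !(tnth_nth x0) -ij.
  by apply: (sortedP x0 ss); rewrite size_tuple ij.
by move=> i j /orP[]/eqP /step //; rewrite adj_sym.
Qed.

Lemma contains_inj (G H F : sgraph) (f : H -> G) : injective f ->
  (forall x y, adj x y -> adj (f x) (f y)) -> contains H F -> contains G F.
Proof.
move=> fi fa [g [gi ga]]; exists (f \o g); split; first exact: inj_comp.
by move=> x y /ga /fa.
Qed.

(** A path is monochromatic, hence too long for its colour class. *)
Lemma path_free_colour (G : sgraph) (C : eqType) (col : G -> C) K :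
    (forall x y, adj x y -> col x = col y) ->
    (forall x, #|[set y | col y == col x]| <= K) ->
  ~ contains G (path_graph K.+1).
Proof.
move=> col_adj fiber [f [fi fa]].
have col0 (i : 'I_K.+1) : col (f i) = col (f ord0).
  case: i => i; elim: i => [|i IH] iK; first by congr (col (f _)); apply: val_inj.
  rewrite -(IH (ltnW iK)); apply/esym/col_adj/fa.
  by rewrite /= /path_rel /= eqxx.
have := fiber (f ord0); rewrite leqNgt => /negP; apply.
rewrite -[K.+1]card_ord -cardsT -(card_imset _ fi).
by apply/subset_leq_card/subsetP => _ /imsetP[i _ ->]; rewrite inE col0.
Qed.

Section Isomorphism.

Implicit Types G H L : sgraph.

Lemma iso_trans G H L : isomorphic G H -> isomorphic H L -> isomorphic G L.
Proof.
move=> [f [fb fa]] [g [gb ga]]; exists (g \o f); split; first exact: bij_comp.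
by move=> x y; rewrite /= ga fa.
Qed.

Lemma iso_sym G H : isomorphic G H -> isomorphic H G.
Proof.
move=> [f [[g fK gK] fa]]; exists g; split; first by exists f.
by move=> x y; rewrite -fa !gK.
Qed.

Lemma iso_refl G : isomorphic G G.
Proof. by exists id; split=> //; exists id. Qed.

Lemma iso_card_inj G H (f : G -> H) : injective f -> #|H| <= #|G| ->
  (forall x y, adj (f x) (f y) = adj x y) -> isomorphic G H.
Proof. by move=> fi le fa; exists f; split=> //; apply: inj_card_bij. Qed.

Lemma iso_union G G' H H' : isomorphic G G' -> isomorphic H H' ->
  isomorphic (disjoint_union G H) (disjoint_union G' H').
Proof.
move=> [f [[f' fK f'K] fa]] [g [[g' gK g'K] ga]].
exists (fun u => match u with inl x => inl (f x) | inr y => inr (g y) end); split.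
  exists (fun u => match u with inl x => inl (f' x) | inr y => inr (g' y) end);
    by case=> x /=; congr (_ _).
by case=> x [] y //=.
Qed.

Lemma iso_unionA G H L :
  isomorphic (disjoint_union G (disjoint_union H L))
             (disjoint_union (disjoint_union G H) L).
Proof.
exists (fun u => match u with inl x => inl (inl x) | inr (inl y) => inl (inr y)
                         | inr (inr z) => inr z end); split.
  exists (fun u => match u with inl (inl x) => inl x | inl (inr y) => inr (inl y)
                           | inr z => inr (inr z) end); by [case=> [|[]] | case=> [[]|]].
by case=> [x|[x|x]] [y|[y|y]].
Qed.

Lemma iso_copies0 G H : isomorphic H (disjoint_union (copies 0 G) H).
Proof.
apply: (@iso_card_inj H (disjoint_union (copies 0 G) H) inr) => //; first by move=> ? ? [].
by rewrite card_sum card_prod card_ord mul0n add0n.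
Qed.

Lemma iso_copiesS q G : isomorphic (disjoint_union G (copies q G)) (copies q.+1 G).
Proof.
pose f (u : disjoint_union G (copies q G)) : copies q.+1 G :=
  match u with inl x => (ord0, x) | inr (i, x) => (lift ord0 i, x) end.
apply: (@iso_card_inj _ _ f).
- case=> [x|[i x]] [y|[j y]] E; have := congr1 snd E; have /eqP := congr1 fst E.
  + by move=> _ /= ->.
  + by rewrite /= (negPf (neq_lift _ _)).
  + by rewrite /= eq_sym (negPf (neq_lift _ _)).
  + by rewrite /= (inj_eq (@lift_inj _ _)) => /eqP -> ->.
- by rewrite card_sum !card_prod !card_ord mulSn.
- by case=> [x|[i x]] [y|[j y]].
Qed.

Lemma iso_complete G n : #|G| = n -> (forall x y : G, x != y -> adj x y) ->
  isomorphic G (complete n).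
Proof.
move=> cG all; pose f (x : G) : complete n := cast_ord cG (enum_rank x).
apply: (@iso_card_inj _ _ f).
- by move=> x y /cast_ord_inj /enum_rank_inj.
- by rewrite card_ord cG.
move=> x y; rewrite /= /complete_rel (inj_eq (@cast_ord_inj _ _ _)) (inj_eq enum_rank_inj).
by case: eqVneq => [->|/all ->]; rewrite ?adj_irr.
Qed.

End Isomorphism.

(** * Clique counts under isomorphism and disjoint union *)

Section Counting.

Variable t : nat.
Implicit Types G H L : sgraph.

Lemma num_cliques_embed G H (f : H -> G) : injective f ->
    (forall x y, adj (f x) (f y) = adj x y) ->
  num_cliques t H = cliques_in (@adj G) t (f @: setT).
Proof.
move=> fi fa; rewrite num_cliquesE /cliques_in.
rewrite -(card_imset _ (imset_inj fi)); apply: eq_card => S.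
have cl (R : {set H}) : clique (@adj G) (f @: R) = clique (@adj H) R.
  apply/cliqueP/cliqueP => cR x y.
    by move=> xR yR nxy; rewrite -fa cR ?imset_f // inj_eq.
  by move=> /imsetP[a aR ->] /imsetP[b bR ->]; rewrite fa inj_eq //; apply: cR.
apply/imsetP/idP => [[R + ->]|].
  by rewrite !inE => /and3P[RT cR sR]; rewrite imsetS // cl cR card_imset.
rewrite inE => /and3P[SI cS sS]; have SE : S = f @: (f @^-1: S).
  apply/setP => x; apply/idP/imsetP => [xS|[y + ->]]; last by rewrite inE.
  by have /imsetP[y _ xE] := subsetP SI x xS; exists y; rewrite // inE -xE.
exists (f @^-1: S) => //; rewrite inE subsetT -cl -SE cS.
by rewrite -(card_imset _ fi) -SE sS.
Qed.

Lemma num_cliques_iso G H : isomorphic G H -> num_cliques t G = num_cliques t H.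
Proof.
move=> [f [fb fa]]; rewrite (num_cliques_embed (bij_inj fb) fa) num_cliquesE.
congr cliques_in; apply/setP => y; rewrite inE; case: fb => g _ gK.
by apply/imsetP; exists (g y); rewrite ?gK.
Qed.

Lemma num_cliques_complete n : num_cliques t (complete n) = 'C(n, t).
Proof.
rewrite num_cliquesE cliques_in_clique ?cardsT ?card_ord //.
by apply/cliqueP.
Qed.

(** No clique meets both sides. Positivity of [t] matters because the empty clique would be counted
    twice. *)
Lemma cliques_in_closed (T : finType) (e : rel T) (U : {set T}) :
    0 < t -> symmetric e -> (forall x y, x \in U -> y \notin U -> ~~ e x y) ->
  cliques_in e t setT = cliques_in e t U + cliques_in e t (~: U).
Proof.
move=> t0 es cl; rewrite /cliques_in.
set F := [set S | _]; set F1 := [set S | _]; set F2 := [set S | _].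
have -> : F = F1 :|: F2.
  apply/setP => S; rewrite !inE subsetT -andb_orl /=.
  case cS : (clique e S); rewrite ?andbF //; case: eqP => [sS|]; rewrite ?andbF //=.
  rewrite !andbT; apply/esym/orP.
  have /card_gt0P[x xS] : 0 < #|S| by rewrite sS.
  have go y : y \in S -> (y \in U) = (x \in U).
    move=> yS; case: (eqVneq y x) => [->//|nyx].
    have exy := cliqueP _ _ cS _ _ yS xS nyx.
    apply/idP/idP => [yU|xU]; apply: contraLR exy => nU; first exact: cl.
    by rewrite es; apply: cl.
  by case xU: (x \in U); [left|right]; apply/subsetP => y /go; rewrite ?inE xU => ->.
rewrite cardsU; have -> : F1 :&: F2 = set0; last by rewrite cards0 subn0.
apply/setP => S; rewrite !inE; apply/negP => /andP[/and3P[S1 _ /eqP sS] /and3P[S2 _ _]].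
have /card_gt0P[x xS] : 0 < #|S| by rewrite sS.
by have := subsetP S2 x xS; rewrite inE (subsetP S1).
Qed.

Lemma num_cliques_union G H : 0 < t ->
  num_cliques t (disjoint_union G H) = num_cliques t G + num_cliques t H.
Proof.
move=> t0; pose D := disjoint_union G H.
rewrite (@num_cliques_embed D G inl) //; last by move=> ? ? [].
rewrite (@num_cliques_embed D H inr) //; last by move=> ? ? [].
have cl (u v : D) : u \in inl @: [set: G] -> v \notin inl @: [set: G] -> ~~ adj u v.
  by case: v => y /imsetP[x _ ->] //; rewrite imset_f.
rewrite num_cliquesE (cliques_in_closed t0 (@adj_sym D) cl).
congr (_ + cliques_in _ _ _); apply/setP => -[x|x]; rewrite inE.
  by rewrite imset_f //; apply/esym/negP => /imsetP[].
by rewrite [RHS]imset_f //; apply/negP => /imsetP[].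
Qed.

Lemma num_cliques_copies q G : 0 < t ->
  num_cliques t (copies q G) = q * num_cliques t G.
Proof.
move=> t0; elim: q => [|q IH].
  apply/eqP; rewrite -leqn0 num_cliquesE; apply: leq_trans (cliques_in_le_bin _ _ _) _.
  by rewrite cardsT card_prod card_ord mul0n bin0n; case: t t0.
by rewrite -(num_cliques_iso (iso_copiesS q G)) num_cliques_union // IH mulSn.
Qed.

End Counting.

(** * Induced subgraphs and splitting off a union of components *)

Definition induced_rel (G : sgraph) (U : {set G}) : rel {x | x \in U} :=
  fun x y => adj (val x) (val y).

Lemma induced_sym (G : sgraph) (U : {set G}) : symmetric (@induced_rel G U).
Proof. by move=> x y; apply: adj_sym. Qed.

Lemma induced_irr (G : sgraph) (U : {set G}) : irreflexive (@induced_rel G U).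
Proof. by move=> x; apply: adj_irr. Qed.

Definition induced (G : sgraph) (U : {set G}) : sgraph :=
  SGraph (@induced_sym G U) (@induced_irr G U).

Section Induced.

Variables (G : sgraph) (U : {set G}).

Lemma card_induced : #|induced U| = #|U|.
Proof. by rewrite card_sig; apply: eq_card. Qed.

Lemma num_cliques_induced t : num_cliques t (induced U) = cliques_in (@adj G) t U.
Proof.
rewrite (@num_cliques_embed _ G (induced U) val) //; last exact: val_inj.
congr cliques_in; apply/setP => x; apply/imsetP/idP => [[y _ ->]|xU]; first exact: valP.
by exists (exist _ x xU).
Qed.

Lemma induced_free F : ~ contains G F -> ~ contains (induced U) F.
Proof.
move=> nG cF; apply: nG; apply: (@contains_inj G (induced U) F val) cF => //.
exact: val_inj.
Qed.

End Induced.

Section Split.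

Variables (G : sgraph) (U : {set G}).
Hypothesis closedU : forall x y, x \in U -> y \notin U -> ~~ adj x y.

Lemma num_cliques_split t : 0 < t ->
  num_cliques t G = num_cliques t (induced U) + num_cliques t (induced (~: U)).
Proof.
move=> t0; rewrite !num_cliques_induced num_cliquesE.
exact: (cliques_in_closed t0 (@adj_sym G) closedU).
Qed.

Lemma iso_split : isomorphic G (disjoint_union (induced U) (induced (~: U))).
Proof.
apply: iso_sym.
pose f (u : disjoint_union (induced U) (induced (~: U))) : G :=
  match u with inl x => val x | inr y => val y end.
apply: (@iso_card_inj _ _ f).
- case=> [[x xU]|[x xU]] [[y yU]|[y yU]] /= E; subst y.
  + by congr inl; apply: val_inj.
  + by exfalso; move: yU; rewrite inE xU.
  + by exfalso; move: xU; rewrite inE yU.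
  + by congr inr; apply: val_inj.
- by rewrite card_sum !card_induced cardsC.
- case=> [[x xU]|[x xU]] [[y yU]|[y yU]] //=; apply/negbTE.
    by apply: closedU xU _; move: yU; rewrite inE.
  by rewrite adj_sym; apply: closedU yU _; move: xU; rewrite inE.
Qed.

End Split.

(** * The upper bound and the structure of extremal graphs *)

Section Extremal.

Variables t K : nat.
Hypotheses (t3 : 2 < t) (tK : t <= K).
Implicit Types G L : sgraph.

(** Both claims go through one induction on the order: a disconnected graph is cut along a component
    and [bnd] is superadditive. Strictness comes from a part with at least [K] vertices or, if both
    parts are smaller, from [bnd_superadd_strict]. *)
Lemma num_cliques_bound G : ~ contains G (path_graph K.+1) ->
  num_cliques t G <= bnd t K #|G| /\
  (K <= #|G| -> (forall S : {set G}, is_clique S -> #|S| != K) ->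
   num_cliques t G < bnd t K #|G|).
Proof.
have [n] := ubnP #|G|; elim: n G => // n IH G /ltnSE le free.
have t0 : 0 < t by lia.
have bnd_small m : m < K -> bnd t K m = 'C(m, t).
  by move=> mK; have := @bndE t K t3 tK 0 m mK; rewrite !mul0n !add0n.
have le_bin H : num_cliques t H <= 'C(#|H|, t).
  by rewrite num_cliquesE -cardsT cliques_in_le_bin.
have [GK|KG] := ltnP #|G| K.
  by rewrite bnd_small.
have free' : ~~ has_path (@adj G) K.+1 by apply/negP => /has_path_contains.
have [/forallP conn|] := boolP [forall x : G, [forall y, connect (@adj G) x y]].
  have conn' x y : connect (@adj G) x y by apply/forallP.
  (* On exactly [K] vertices the bound is ['C(K, t)], and equality would make the whole graph a
     [K_K]. *)
  move: KG; rewrite leq_eqVlt => /orP[/eqP KG|KG].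
    have bndK : bnd t K #|G| = 'C(#|G|, t).
      have := @bndE t K t3 tK 1 0; rewrite mul1n addn0 -KG => ->; last by lia.
      by rewrite mul1n (bin_small t0) addn0.
    rewrite bndK; split=> // _ noK; rewrite ltn_neqAle le_bin andbT.
    apply/eqP => E; have cT : is_clique [set: G].
      apply: (@cliques_in_full _ (@adj G) t); rewrite ?cardsT -?KG //; first by lia.
      by rewrite -num_cliquesE E KG.
    by have := noK _ cT; rewrite cardsT KG eqxx.
  have lt : num_cliques t G < bnd t K #|G|.
    rewrite num_cliquesE; apply: connected_cliques_lt => //.
      exact: adj_sym.
    exact: adj_irr.
  by split=> //; apply: ltnW.
rewrite negb_forall => /existsP[x]; rewrite negb_forall => /existsP[y nxy].
pose U := [set z | connect (@adj G) x z].
have cl u v : u \in U -> v \notin U -> ~~ adj u v.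
  rewrite !inE => xu; apply: contra => uv; exact: connect_trans xu (connect1 uv).
have cU : 0 < #|U| by apply/card_gt0P; exists x; rewrite inE connect0.
have cCU : 0 < #|~: U| by apply/card_gt0P; exists y; rewrite !inE.
have cG : #|G| = #|induced U| + #|induced (~: U)| by rewrite !card_induced cardsC.
have sub (V : {set G}) : #|V| < n -> num_cliques t (induced V) <= bnd t K #|induced V| /\
  (K <= #|induced V| -> (forall S : {set G}, is_clique S -> #|S| != K) ->
   num_cliques t (induced V) < bnd t K #|induced V|).
  move=> Vn; have [|le1 lt1] := IH (induced V) _ (induced_free free).
    by rewrite card_induced.
  split=> // KV noK; apply: lt1 => // S /cliqueP cS.
  rewrite -(card_imset _ val_inj); apply: noK.
  apply/cliqueP => _ _ /imsetP[a aS ->] /imsetP[b bS ->]; rewrite inj_eq; last exact: val_inj.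
  exact: cS.
have [|leU ltU] := sub U; first by move: le; rewrite cG !card_induced; lia.
have [|leC ltC] := sub (~: U); first by move: le; rewrite cG !card_induced; lia.
rewrite (num_cliques_split cl t0) cG.
have sup := @bnd_superadd t K t3 tK #|induced U| #|induced (~: U)|.
split; first by apply: leq_trans sup; apply: leq_add.
rewrite cG in KG; move=> _ noK; have [KU|UK] := leqP K #|induced U|.
  by apply: leq_trans sup; rewrite -addSn leq_add // ltU.
have [KC|CK] := leqP K #|induced (~: U)|.
  by apply: leq_trans sup; rewrite -addnS leq_add // ltC.
apply: leq_ltn_trans (bnd_superadd_strict t3 tK UK CK KG).
by rewrite leq_add.
Qed.

(** While [q > 0], the strict bound forces a [K_K]; it is a component, and the induction on [q]
    continues with its complement. *)
Lemma extremal_structure q r G : r < K -> #|G| = q * K + r ->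
    ~ contains G (path_graph K.+1) -> num_cliques t G = bnd t K #|G| ->
  exists L, [/\ #|L| = r, num_cliques t L = 'C(r, t)
    & isomorphic G (disjoint_union (copies q (complete K)) L)].
Proof.
move=> rK; have t0 : 0 < t by lia.
elim: q G => [|q IH] G cG free nG.
  exists G; split=> //; last exact: iso_copies0.
  by rewrite nG cG bndE.
have [_ lt] := num_cliques_bound free.
have [/existsP[S /andP[cS /eqP sS]]|noK] :=
  boolP [exists S : {set G}, is_clique S && (#|S| == K)]; last first.
  have : num_cliques t G < bnd t K #|G|.
    apply: lt => [|S cS]; first by rewrite cG mulSn; lia.
    by apply: contra noK => sS; apply/existsP; exists S; rewrite cS.
  by rewrite nG ltnn.
have cl u v : u \in S -> v \notin S -> ~~ adj u v.
  apply: clique_closed => //; first exact: adj_sym.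
  by rewrite sS; apply/negP => /has_path_contains.
have cC : #|induced (~: S)| = q * K + r.
  have := cardsC S; rewrite card_induced sS cG mulSn; lia.
have nS : num_cliques t (induced S) = 'C(K, t).
  by rewrite num_cliques_induced cliques_in_clique ?sS.
(* Removing [K] vertices lowers [bnd] by exactly ['C(K, t)], so the rest is extremal again. *)
have nC : num_cliques t (induced (~: S)) = bnd t K #|induced (~: S)|.
  have := num_cliques_split cl t0; rewrite nG nS cC cG !bndE // mulSn; lia.
have [L [cL nL isoL]] := IH _ cC (induced_free free) nC.
exists L; split=> //; apply: iso_trans (iso_split cl) _.
have isoS : isomorphic (induced S) (complete K).
  apply: iso_complete; first by rewrite card_induced.
  move=> x y nxy; apply: (cliqueP _ _ cS); rewrite ?(valP x) ?(valP y) //.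
apply: iso_trans (iso_union isoS isoL) _.
apply: iso_trans (iso_unionA _ _ _) _.
exact: iso_union (iso_copiesS _ _) (iso_refl _).
Qed.

End Extremal.

(** * The extremal graph and the conclusion *)

Lemma card_union_copies q K (L : sgraph) :
  #|disjoint_union (copies q (complete K)) L| = q * K + #|L|.
Proof. by rewrite card_sum card_prod !card_ord. Qed.

Lemma union_copies_free q K r : r <= K ->
  ~ contains (disjoint_union (copies q (complete K)) (complete r)) (path_graph K.+1).
Proof.
move=> rK; pose G := disjoint_union (copies q (complete K)) (complete r).
(* Vertices are coloured by their block: the index of the copy, or [None] for the remaining complete
   graph. *)
pose col (u : G) := match u with inl p => Some p.1 | inr _ => None end.
apply: (@path_free_colour G _ col).
  by case=> [[i x]|x] [[j y]|y] //= /andP[/= /eqP -> _].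
case=> [[i x]|x].
  apply: (@leq_trans #|(fun y => inl (i, y) : G) @: [set: 'I_K]|).
    apply/subset_leq_card/subsetP => -[[j y]|y]; rewrite inE //= => /eqP[->].
    exact: imset_f.
  by apply: leq_trans (leq_imset_card _ _) _; rewrite cardsT card_ord.
apply: (@leq_trans #|(fun y => inr y : G) @: [set: 'I_r]|).
  apply/subset_leq_card/subsetP => -[[j y]|y]; rewrite inE //= => _.
  exact: imset_f.
by apply: leq_trans (leq_imset_card _ _) _; rewrite cardsT card_ord.
Qed.

Theorem theorem1p6 (n t k q r : nat)
    (hn : 0 < n) (ht : 3 <= t) (htk : t < k)
    (hdiv : n = q * (k - 1) + r) (hr : r <= k - 2) :
  let extremal := disjoint_union (copies q (complete (k - 1))) (complete r) in
  (forall G : sgraph, #|G| = n -> ~ contains G (path_graph k) ->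
     num_cliques t G <= num_cliques t extremal)
  /\
  (t <= r ->
     [/\ #|extremal| = n, ~ contains extremal (path_graph k)
       & forall G : sgraph, #|G| = n -> ~ contains G (path_graph k) ->
           num_cliques t G = num_cliques t extremal -> isomorphic G extremal])
  /\
  (r < t ->
     forall G : sgraph, #|G| = n -> ~ contains G (path_graph k) ->
       (num_cliques t G = num_cliques t extremal <->
        exists L : sgraph, #|L| = r /\
          isomorphic G (disjoint_union (copies q (complete (k - 1))) L))).
Proof.
case: k htk hdiv hr => // K tK; rewrite subSS subn0 => nE hr.
have rK : r < K by lia.
have t0 : 0 < t by lia.
move=> X.
have nX : num_cliques t X = bnd t K n.
  by rewrite num_cliques_union // num_cliques_copies // !num_cliques_complete nE bndE.
rewrite nX; split; [|split].
- by move=> G <- free; case: (num_cliques_bound ht tK free).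
- move=> tr; split.
  + by rewrite nE /X card_union_copies card_ord.
  + exact: union_copies_free (ltnW rK).
  move=> G cG free nG; have cG' := etrans cG nE; rewrite -cG in nG.
  have [L [cL nL isoL]] := extremal_structure ht tK rK cG' free nG.
  apply: iso_trans isoL _; apply: iso_union (iso_refl _) _.
  apply: iso_complete => // x y nxy.
  (* [L] has ['C(r, t)] cliques on [r >= t] vertices, so it is complete. *)
  have /cliqueP cl : clique (@adj L) setT.
    by apply: (@cliques_in_full _ _ t); rewrite ?cardsT ?cL -?num_cliquesE //; lia.
  by apply: cl.
move=> rt G cG free; have cG' := etrans cG nE; split=> [nG|[L [cL isoL]]].
  rewrite -cG in nG.
  have [L [cL _ isoL]] := extremal_structure ht tK rK cG' free nG.
  by exists L.
rewrite (num_cliques_iso t isoL) num_cliques_union // num_cliques_copies //.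
rewrite num_cliques_complete nE bndE // (bin_small rt) addn0.
(* With fewer than [t] vertices, [L] contributes nothing, whatever its edges. *)
have : num_cliques t L <= 'C(#|L|, t).
  by rewrite num_cliquesE -cardsT cliques_in_le_bin.
by rewrite cL bin_small // leqn0 => /eqP ->; rewrite addn0.
Qed.
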